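(* For the generic $f \in \mathcal{C}(\{0,1\}^{\mathbb{N}})$, the induced map $\widetilde{f} : \mathcal{M}(\{0,1\}^{\mathbb{N}}) \to \mathcal{M}(\{0,1\}^{\mathbb{N}})$ is equicontinuous at every point. That is, the set of all $f \in \mathcal{C}(\{0,1\}^{\mathbb{N}})$ for which $\widetilde{f}$ fails to be equicontinuous at some point of $\mathcal{M}(\{0,1\}^{\mathbb{N}})$ is of the first category in $\mathcal{C}(\{0,1\}^{\mathbb{N}})$.
   Context: The Cantor space $\{0,1\}^{\mathbb{N}}$ ($\mathbb{N}=\{1,2,\dots\}$) carries the metric $d(\sigma,\sigma)=0$ and $d(\sigma,\tau)=1/n$, where $n$ is the least positive integer with $\sigma(n)\ne\tau(n)$. $\mathcal{C}(\{0,1\}^{\mathbb{N}})$ is the space of all continuous maps from $\{0,1\}^{\mathbb{N}}$ into itself with the metric $\tilde d(f,g)=\max_x d(f(x),g(x))$; it is a Baire space. ''The generic element of a Baire space $Z$ has property $P$'' means that the set of elements of $Z$ failing $P$ is of the first category (meager) in $Z$. For a compact metric space $(M,d)$, $\mathcal{M}(M)$ is the space of Borel probability measures on $M$ with the Prohorov metric $d_P(\mu,\nu)=\inf\{\delta>0:\mu(X)\le\nu(X^\delta)+\delta \text{ and } \nu(X)\le\mu(X^\delta)+\delta \text{ for all Borel } X\subset M\}$, where $X^\delta=\{x\in M: d(x,X)<\delta\}$; it is a compact metric space. For a continuous map $f:M\to M$, the induced map $\widetilde f:\mathcal{M}(M)\to\mathcal{M}(M)$ is $(\widetilde f(\mu))(X)=\mu(f^{-1}(X))$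 for Borel $X$. A self-map $g$ of a metric space with metric $\rho$ is equicontinuous at a point $x$ if for every $\varepsilon>0$ there exists $\delta>0$ such that $\rho(y,x)<\delta$ implies $\rho(g^n(y),g^n(x))<\varepsilon$ for all $n\ge 0$. *)

(* Defs.v *)
From HB Require Import structures.
From mathcomp Require Import all_boot all_order all_algebra.
From mathcomp Require Import finmap.
From mathcomp Require Import all_classical all_reals all_analysis.

Set Implicit Arguments.
Unset Strict Implicit.
Unset Printing Implicit Defensive.

Import Order.TTheory GRing.Theory Num.Theory.
Import numFieldNormedType.Exports.

Local Open Scope classical_set_scope.
Local Open Scope ring_scope.

Section cantor_dist.
Context {R : realType}.
Implicit Types s t u : cantor_space.

(* Sequences are indexed from 0 here, so the first disagreement at index k
   gives the distance 1 / (k + 1). *)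
Definition cantor_dist s t : R :=
  if pselect (exists k, s k != t k) is left h then (ex_minn h).+1%:R^-1 else 0.

Lemma cantor_distxx s : cantor_dist s s = 0.
Proof.
by rewrite /cantor_dist; case: pselect => // h; exfalso; case: h => k; rewrite eqxx.
Qed.

Lemma cantor_dist_ge0 s t : 0 <= cantor_dist s t.
Proof. by rewrite /cantor_dist; case: pselect. Qed.

Lemma cantor_dist_le1 s t : cantor_dist s t <= 1.
Proof.
rewrite /cantor_dist; case: pselect => // h.
by rewrite invf_le1 ?ler1n ?ltr0n.
Qed.

Lemma cantor_dist_ltP s t (n : nat) :
  reflect (forall k, (k <= n)%N -> s k = t k) (cantor_dist s t < n.+1%:R^-1).
Proof.
rewrite /cantor_dist; case: pselect => [h|nh]; last first.
  rewrite invr_gt0 ltr0n; apply: ReflectT => k _.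
  by apply/eqP; apply/negPn/negP => ?; apply: nh; exists k.
case: ex_minnP => m stm mmin.
rewrite ltf_pV2 ?posrE ?ltr0n// ltr_nat ltnS.
apply: (iffP idP) => [nm k kn|st].
  apply/eqP; apply/negPn/negP => /mmin mk.
  by have := leq_trans nm (leq_trans mk kn); rewrite ltnn.
rewrite ltnNge; apply/negP => /st stE.
by rewrite stE eqxx in stm.
Qed.

Lemma cantor_dist_eq0 s t : cantor_dist s t = 0 -> s = t.
Proof.
move=> st0; apply/funext => k.
have /cantor_dist_ltP : cantor_dist s t < k.+1%:R^-1.
  by rewrite st0 invr_gt0 ltr0n.
exact.
Qed.

Lemma cantor_dist_sym s t : cantor_dist s t = cantor_dist t s.
Proof.
have sub a b : cantor_dist a b <= cantor_dist b a.
  rewrite leNgt; apply/negP; rewrite {2}/cantor_dist.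
  case: pselect => [h|_]; last by rewrite ltNge cantor_dist_ge0.
  case: ex_minnP => m abm _ /cantor_dist_ltP/(_ m (leqnn m)) bam.
  by rewrite bam eqxx in abm.
by apply/eqP; rewrite eq_le !sub.
Qed.

Lemma cantor_dist_ultra t s u :
  cantor_dist s u <= Num.max (cantor_dist s t) (cantor_dist t u).
Proof.
rewrite leNgt gt_max; apply/negP; rewrite {2 4}/cantor_dist.
case: pselect => [h|_]; last by rewrite ltNge cantor_dist_ge0.
case: ex_minnP => m sum _ /andP[/cantor_dist_ltP/(_ m (leqnn m)) st].
move=> /cantor_dist_ltP/(_ m (leqnn m)) tu.
by rewrite st tu eqxx in sum.
Qed.

Lemma cantor_dist_triangle t s u :
  cantor_dist s u <= cantor_dist s t + cantor_dist t u.
Proof.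
apply: (le_trans (cantor_dist_ultra t s u)).
by rewrite ge_max lerDl lerDr !cantor_dist_ge0.
Qed.

Definition cantor_ball s (e : R) : set cantor_space :=
  [set t | cantor_dist s t < e].

Lemma cantor_ball_center s (e : R) : 0 < e -> cantor_ball s e s.
Proof. by rewrite /cantor_ball/= cantor_distxx. Qed.

Lemma cantor_ball_sym s t (e : R) : cantor_ball s e t -> cantor_ball t e s.
Proof. by rewrite /cantor_ball/= cantor_dist_sym. Qed.

Lemma cantor_ball_triangle s t u (e1 e2 : R) :
  cantor_ball s e1 t -> cantor_ball t e2 u -> cantor_ball s (e1 + e2) u.
Proof.
rewrite /cantor_ball/= => st tu.
by rewrite (le_lt_trans (cantor_dist_triangle t s u))// ltrD.
Qed.

Lemma cantor_entourage_coord k :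
  entourage [set st : cantor_space * cantor_space | st.1 k = st.2 k].
Proof.
pose A := [set st : cantor_space * cantor_space | st.1 k = st.2 k].
have entA : `[< @entourage (@initial_topology cantor_space bool
    (@proj nat (fun=> bool) k)) A >].
  apply/asboolP; exists [set b : bool * bool | b.1 = b.2]; last by [].
  by rewrite uniform_discrete => b [? _ <-].
exists A => //.
set D := (X in finI_from X _); set G := (X in finI_from _ X).
exact: (@finI_from1 _ _ D G (exist _ (k, A) entA)).
Qed.

Lemma cantor_entourageE : @entourage cantor_space = entourage_ cantor_ball.
Proof.
apply/seteqP; split => E.
  move=> [_ [J _ <-] JE].
  pose N := (\max_(p <- enum_fset J) (projT1 p).1)%N.
  exists N.+1%:R^-1; first by rewrite /= invr_gt0 ltr0n.
  move=> [s t] /cantor_dist_ltP/= st; apply: JE => p Jp.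
  have /asboolP[V entV] := projT2 p; apply => /=.
  have stp : s (sval p).1 = t (sval p).1.
    by apply: st; exact: (@leq_bigmax_seq _ (enum_fset J) xpredT
                            (fun p => (projT1 p).1)).
  rewrite [X in V X](_ : _ = (s (sval p).1, s (sval p).1)).
    exact: entourage_refl.
  exact: (congr1 (pair (s (sval p).1)) (esym stp)).
move=> [e /= e0 eE].
have [n ne] : exists n : nat, n.+1%:R^-1 < e.
  exists (Num.truncn e^-1); rewrite -[ltRHS]invrK ltf_pV2 ?posrE ?invr_gt0//.
  by rewrite truncnS_gt.
have : entourage [set st : cantor_space * cantor_space |
    forall k : 'I_n.+1, st.1 k = st.2 k].
  apply: (@filter_forall _ _ (fun (k : 'I_n.+1)
    (st : cantor_space * cantor_space) => st.1 k = st.2 k) _ entourage_filter) => k.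
  exact: cantor_entourage_coord.
apply: filterS => -[s t]/= st; apply: eE => /=.
apply: lt_trans ne; apply/cantor_dist_ltP => k kn.
exact: (st (Ordinal (kn : (k < n.+1)%N))).
Qed.

End cantor_dist.

HB.instance Definition _ (R : realType) :=
  Uniform_isPseudoMetric.Build R cantor_space
    (@cantor_ball_center R) (@cantor_ball_sym R) (@cantor_ball_triangle R)
    (@cantor_entourageE R).

HB.instance Definition _ (R : realType) :=
  @PseudoMetric_isMetric.Build R cantor_space cantor_dist
    (@cantor_dist_ge0 R) (@cantor_dist_eq0 R) (fun _ _ => erefl).

(* The library topology on continuousType is not the one of uniform
   convergence; this alias (indexed by the codomain R of the metric) carries
   the topology of the metric max_x d (f x) (g x) instead. *)
Definition cantor_maps (R : realType) : Type :=
  continuousType cantor_space cantor_space.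

HB.instance Definition _ (R : realType) := Choice.on (cantor_maps R).

Section cantor_maps_dist.
Context {R : realType}.
Implicit Types f g h : cantor_maps R.

Definition cantor_maps_dist f g : R :=
  sup (range (fun x => cantor_dist (f x) (g x))).

Lemma cantor_maps_dist_has_sup f g :
  has_sup (range (fun x => @cantor_dist R (f x) (g x))).
Proof.
split; first by exists (cantor_dist (f point) (g point)), point.
by exists 1 => _ [x _ <-]; exact: cantor_dist_le1.
Qed.

Lemma cantor_maps_dist_ge f g x : cantor_dist (f x) (g x) <= cantor_maps_dist f g.
Proof. by apply: sup_ubound; [have [] := cantor_maps_dist_has_sup f g|exists x]. Qed.

Lemma cantor_maps_dist_le f g (e : R) :
  (forall x, cantor_dist (f x) (g x) <= e) -> cantor_maps_dist f g <= e.
Proof.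
move=> fge; apply: sup_le_ub; first by have [] := cantor_maps_dist_has_sup f g.
by move=> _ [x _ <-].
Qed.

Lemma cantor_maps_dist_max f g :
  exists x, cantor_maps_dist f g = cantor_dist (f x) (g x).
Proof.
have [exk|fg] := pselect (exists k, `[< exists x, f x k != g x k >]).
  have [k /asboolP[x xk] kmin] := ex_minnP exk.
  exists x; apply/eqP; rewrite eq_le cantor_maps_dist_ge andbT.
  apply: cantor_maps_dist_le => y.
  rewrite /cantor_dist; case: pselect => [hy|_]; last by case: pselect.
  case: pselect => [hx|[]]; last by exists k.
  case: ex_minnP => m ym _; case: ex_minnP => n xn nmin.
  rewrite lef_pV2 ?posrE ?ltr0n// ler_nat ltnS.
  apply: (leq_trans (nmin _ xk)); apply: kmin.
  by apply/asboolP; exists y.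
have {}fg x : f x = g x.
  apply/funext => k; apply/eqP; apply/negPn/negP => fgk.
  by apply: fg; exists k; apply/asboolP; exists x.
exists point; apply/eqP; rewrite eq_le cantor_maps_dist_ge andbT.
by apply: cantor_maps_dist_le => x; rewrite !fg !cantor_distxx.
Qed.

Lemma cantor_maps_distxx f : cantor_maps_dist f f = 0.
Proof. by have [x ->] := cantor_maps_dist_max f f; rewrite cantor_distxx. Qed.

Lemma cantor_maps_dist_eq0 f g : cantor_maps_dist f g = 0 -> f = g.
Proof.
move=> fg0; apply/continuousEP => x; apply: (@cantor_dist_eq0 R).
by apply/eqP; rewrite eq_le cantor_dist_ge0 -fg0 cantor_maps_dist_ge.
Qed.

Lemma cantor_maps_dist_sym f g : cantor_maps_dist f g = cantor_maps_dist g f.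
Proof.
by apply/eqP; rewrite eq_le; apply/andP; split; apply: cantor_maps_dist_le => x;
   rewrite cantor_dist_sym cantor_maps_dist_ge.
Qed.

Lemma cantor_maps_dist_triangle g f h :
  cantor_maps_dist f h <= cantor_maps_dist f g + cantor_maps_dist g h.
Proof.
apply: cantor_maps_dist_le => x.
apply: (le_trans (cantor_dist_triangle (g x) _ _)).
by apply: lerD; exact: cantor_maps_dist_ge.
Qed.

End cantor_maps_dist.

HB.instance Definition _ (R : realType) :=
  isMetric.Build R (cantor_maps R) (@cantor_maps_distxx R)
    (@cantor_maps_dist_eq0 R) (@cantor_maps_dist_sym R)
    (@cantor_maps_dist_triangle R).

Definition nowhere_dense (T : topologicalType) (A : set T) :=
  (closure A)^° = set0.

Definition meager (T : topologicalType) (A : set T) :=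
  exists2 F : (set T)^nat, (forall n, nowhere_dense (F n)) & A = \bigcup_n F n.

Definition cantor_borel : Type := g_sigma_algebraType (@open cantor_space).

HB.instance Definition _ := Measurable.on cantor_borel.

(* A probability of the library also has (arbitrary) values on non-measurable
   sets. These are ignored by prohorov below, which is therefore a pseudometric
   on this type and a metric up to equality on Borel sets. *)
Definition cantor_measures (R : realType) : Type := probability cantor_borel R.

Section prohorov.
Local Open Scope ereal_scope.
Context {R : realType} {d : measure_display} {T : measurableType d}.
Variable rho : T -> T -> R.

(* The infimum defining the distance to X is taken in \bar R so that it is +oo
   when X is empty. *)
Definition thickening (X : set T) (delta : R) : set T :=
  [set x | ereal_inf [set (rho x y)%:E | y in X] < delta%:E].

Definition prohorov (mu nu : probability T R) : R :=
  inf [set delta : R | (0 < delta)%R /\ forall X, measurable X ->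
    mu X <= nu (thickening X delta) + delta%:E /\
    nu X <= mu (thickening X delta) + delta%:E].

End prohorov.

Definition prohorov_cantor {R : realType} (mu nu : cantor_measures R) : R :=
  prohorov (@cantor_dist R : cantor_borel -> cantor_borel -> R) mu nu.

Definition borel_fun {R : realType} (f : cantor_maps R) :
  cantor_borel -> cantor_borel := f.

Lemma measurable_borel_fun {R : realType} (f : cantor_maps R) :
  measurable_fun setT (borel_fun f).
Proof.
apply: (@measurability _ _ cantor_borel cantor_borel setT (borel_fun f)
  (@open cantor_space) erefl) => _ [B oB <-].
rewrite setTI; apply: sub_sigma_algebra; apply: open_comp => //.
by move=> x _; exact: cts_fun.
Qed.

HB.instance Definition _ {R : realType} (f : cantor_maps R) :=
  isMeasurableFun.Build _ _ cantor_borel cantor_borel (borel_fun f)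
    (measurable_borel_fun f).

Definition induced_map {R : realType} (f : cantor_maps R)
  (mu : cantor_measures R) : cantor_measures R := distribution mu (borel_fun f).

Lemma induced_mapE {R : realType} (f : cantor_maps R) (mu : cantor_measures R)
  (X : set cantor_borel) : induced_map f mu X = mu (f @^-1` X).
Proof. by []. Qed.

Definition equicontinuous_at {R : realType} {M : Type} (rho : M -> M -> R)
    (g : M -> M) (x : M) :=
  forall eps : R, 0 < eps -> exists2 delta : R, 0 < delta &
    forall y, rho y x < delta ->
      forall n, rho (iter n g y) (iter n g x) < eps.

(* Main.v *)
Require Import Defs.
From mathcomp Require Import all_boot all_order all_algebra.
From mathcomp Require Import all_classical all_reals all_analysis.

Set Implicit Arguments.
Unset Strict Implicit.
Unset Printing Implicit Defensive.

Local Open Scope classical_set_scope.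
Local Open Scope ring_scope.

Import Order.TTheory GRing.Theory Num.Theory.

(* Given N, a dense open set of maps f admit some M >= N such that f sends
   cylinders of length M into cylinders of length M: for density, precompose f with truncation to the
   first M coordinates, for M large. If f has this property at M, then preimages
   under f^n of unions of M-cylinders are again unions of M-cylinders, and these
   are unchanged by thickening of radius less than 1/M. Replacing a Borel set by
   the union of the M-cylinders it meets then transports any Prohorov estimate
   at scale below 1/M from (mu, nu) to the images of mu and nu under f^n,
   uniformly in n. *)

(** Indices start at 0, so [agree n] compares [n.+1] coordinates; its classes are the cylinders of
    length [n.+1], which are the open balls of radius 1/(n+1). *)
Definition agree (n : nat) (s t : cantor_space) : Prop :=
  forall k, (k <= n)%N -> s k = t k.

Lemma agree_sym n s t : agree n s t -> agree n t s.
Proof. by move=> st k /st. Qed.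

Lemma agree_trans n t s u : agree n s t -> agree n t u -> agree n s u.
Proof. by move=> st tu k kn; rewrite st// tu. Qed.

Lemma agreeW m n s t : (m <= n)%N -> agree n s t -> agree m s t.
Proof. by move=> mn st k km; apply: st; exact: leq_trans km mn. Qed.

Definition cylinder_stable (n : nat) (f : cantor_space -> cantor_space) :=
  forall s t, agree n s t -> agree n (f s) (f t).

Lemma cylinder_stable_iter n f k :
  cylinder_stable n f -> cylinder_stable n (iter k f).
Proof. by move=> fn; elim: k => // k IH s t /IH; exact: fn. Qed.

Lemma nowhere_dense_subC (T : topologicalType) (U A : set T) :
  open U -> closure U = setT -> A `<=` ~` U -> nowhere_dense A.
Proof.
move=> oU dU AU; rewrite /nowhere_dense -subset0.
have -> : set0 = (~` U)° by rewrite interiorC dU setCT.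
apply: interiorS; rewrite [X in _ `<=` X](closure_id _).1; last exact: open_closedC.
exact: closureS.
Qed.

Section cylinders.
Context (R : realType).
Implicit Types (f g : cantor_maps R) (mu nu : cantor_measures R).
Let rho : cantor_borel -> cantor_borel -> R := @cantor_dist R.

Lemma cantor_dist_agree n s t :
  agree n s t <-> @cantor_dist R s t < n.+1%:R^-1.
Proof. by split => [st|/cantor_dist_ltP//]; exact/cantor_dist_ltP. Qed.

Lemma nbhs_agree n (s : cantor_space) : nbhs s [set t | agree n s t].
Proof.
apply/(@nbhs_ballP R); exists n.+1%:R^-1.
  by rewrite /= invr_gt0 ltr0n.
by move=> t st; apply/cantor_dist_agree; exact: st.
Qed.

Lemma nbhs_agreeP (s : cantor_space) (A : set cantor_space) :
  nbhs s A -> exists n, [set t | agree n s t] `<=` A.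
Proof.
move=> /(@nbhs_ballP R)[e /= e0 eA].
have [n ne] := ltr_add_invr e0; rewrite add0r in ne.
exists n => t /cantor_dist_agree st; apply: eA.
exact: lt_trans st ne.
Qed.

Lemma continuous_agree (f : cantor_space -> cantor_space) :
  (forall n s, exists m, forall t, agree m s t -> agree n (f s) (f t)) ->
  continuous f.
Proof.
move=> fc s A /nbhs_agreeP[n nA]; have [m mf] := fc n s.
by apply: filterS (nbhs_agree m s) => t st; apply: nA; exact: mf.
Qed.

(** Compactness of the Cantor space turns the moduli of continuity at single points into one valid
    everywhere. *)
Lemma uniform_agree (f : continuousType cantor_space cantor_space) (n : nat) :
  exists m, forall s t, agree m s t -> agree n (f s) (f t).
Proof.
pose P m s := forall t, agree m s t -> agree n (f s) (f t).
have [m _ mP] : \forall m \near \oo, forall s, setT s -> P m s.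
  have /compact_near_coveringP := cantor_space_compact.
  apply => s _.
  have [m mf] := nbhs_agreeP (@cts_fun _ _ f s _ (nbhs_agree n (f s))).
  exists ([set t | agree m s t], [set k | (m <= k)%N]).
    by split; [exact: nbhs_agree|exists m].
  move=> [t k] [/= st mk] u /(agreeW mk) tu.
  apply: agree_trans (agree_sym (mf _ st)) _.
  by apply: mf; exact: agree_trans st tu.
by exists m => s t; exact: mP (leqnn m) s I t.
Qed.

(** A retraction collapsing each cylinder of length [n.+1] to a point: precomposing with it makes
    any map constant on these cylinders. *)
Definition trunc (n : nat) (s : cantor_space) : cantor_space :=
  fun k => if (k <= n)%N then s k else false.

Lemma agree_trunc n s : agree n s (trunc n s).
Proof. by move=> k kn; rewrite /trunc kn. Qed.

Lemma trunc_agree n s t : agree n s t -> trunc n s = trunc n t.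
Proof. by move=> st; apply/funext => k; rewrite /trunc; case: ifPn => // /st. Qed.

Lemma continuous_trunc n : continuous (trunc n).
Proof. by apply: continuous_agree => m s; exists n => t /trunc_agree ->. Qed.

Definition eventually_stable N : set (cantor_maps R) :=
  [set f | exists2 n, (N <= n)%N & cylinder_stable n f].

(** A map within 1/(n+1) of [f] agrees with [f] through index [n] at every point, so it is stable at
    the same [n]. *)
Lemma open_eventually_stable N : open (eventually_stable N).
Proof.
rewrite openE => f [n Nn fn]; apply/(@nbhs_ballP R); exists n.+1%:R^-1.
  by rewrite /= invr_gt0 ltr0n.
move=> g fg; exists n => // s t st.
have close u : agree n (f u) (g u).
  apply/cantor_dist_agree; exact: le_lt_trans (cantor_maps_dist_ge _ _ _) fg.
apply: agree_trans (agree_sym (close s)) _.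
exact: agree_trans (fn _ _ st) (close t).
Qed.

Lemma dense_eventually_stable N : closure (eventually_stable N) = setT.
Proof.
apply/seteqP; split => // f _ A /(@nbhs_ballP R)[e /= e0 eA].
have [n ne] := ltr_add_invr e0; rewrite add0r in ne.
have [m mf] := uniform_agree f n.
(* [M >= N] puts [g] in [eventually_stable N]; [M >= m] makes [f] and [g] agree through index
   [n]. *)
pose M := maxn N m.
pose g : cantor_maps R := f \o mkcts (@continuous_trunc M).
exists g; split.
  exists M; first exact: leq_maxl.
  by move=> s t /trunc_agree st; rewrite /g /= /mkcts st.
apply: eA; apply: le_lt_trans ne; apply: cantor_maps_dist_le => s.
apply/ltW/cantor_dist_agree/mf.
exact: agreeW (leq_maxr N m) (@agree_trunc M s).
Qed.

Definition hull (n : nat) (X : set cantor_borel) : set cantor_borel :=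
  [set y | exists2 x, X x & agree n x y].

Lemma measurable_cantor_open (X : set cantor_borel) :
  (forall x : cantor_space, X x -> nbhs x (X : set cantor_space)) ->
  measurable X.
Proof. by move=> oX; apply: sub_sigma_algebra; rewrite /= openE. Qed.

Lemma measurable_hull n X : measurable (hull n X).
Proof.
apply: measurable_cantor_open => y [x Xx xy].
apply: filterS (nbhs_agree n y) => z yz; exists x => //.
exact: agree_trans xy yz.
Qed.

(** A thickening is open: by the ultrametric inequality it contains, with each of its points, the
    whole ball of radius [d] around it. *)
Lemma measurable_thickening X (d : R) : measurable (thickening rho X d).
Proof.
apply: measurable_cantor_open => x /ereal_inf_lt[_ [y Xy <-]].
rewrite lte_fin => xy; apply/(@nbhs_ballP R); exists d.
  exact: le_lt_trans (cantor_dist_ge0 _ _) xy.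
move=> z xz; apply: (@le_lt_trans _ _ (rho z y)%:E).
  by apply: ereal_inf_lbound; exists y.
rewrite lte_fin; apply: le_lt_trans (cantor_dist_ultra x z y) _.
by rewrite gt_max xy cantor_dist_sym; apply/andP; split => //; exact: xz.
Qed.

Lemma hull_id n X : (forall s t, agree n s t -> X s -> X t) -> hull n X = X.
Proof.
move=> sX; apply/seteqP; split => [y [x Xx xy]|x Xx]; first exact: sX xy Xx.
by exists x.
Qed.

Lemma thickening_hull n X (d : R) :
  d <= n.+1%:R^-1 -> thickening rho X d `<=` hull n X.
Proof.
move=> dn x /ereal_inf_lt[_ [y Xy <-]]; rewrite lte_fin => xy.
exists y => //; apply: agree_sym; apply/cantor_dist_agree.
exact: lt_le_trans xy dn.
Qed.

Lemma hull_thickening n X : hull n X = thickening rho X n.+1%:R^-1.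
Proof.
apply/seteqP; split; last exact: thickening_hull.
move=> x [y Xy /agree_sym/cantor_dist_agree xy].
apply: (@le_lt_trans _ _ (rho x y)%:E); last by rewrite lte_fin.
by apply: ereal_inf_lbound; exists y.
Qed.

Lemma iter_induced_mapE f mu k (X : set cantor_borel) :
  iter k (induced_map f) mu X = mu (iter k f @^-1` X).
Proof.
by elim: k X => // k IH X; rewrite iterS induced_mapE IH.
Qed.

(** The preimage [Z] of the hull of [X] is a union of cylinders, so thickening by [d] does not
    enlarge it, and the hypothesis is needed at [Z] only. Being one-sided, the estimate serves both
    inequalities of the Prohorov condition. *)
Lemma iter_induced_map_le f mu nu n k (d : R) X :
  cylinder_stable n f -> d <= n.+1%:R^-1 ->
  (forall Z, measurable Z -> mu Z <= nu (thickening rho Z d) + d%:E)%E ->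
  measurable X ->
  (iter k (induced_map f) mu X <=
   iter k (induced_map f) nu (thickening rho X n.+1%:R^-1) + n.+1%:R^-1%:E)%E.
Proof.
move=> /(@cylinder_stable_iter _ _ k) fn dn munu mX.
rewrite -hull_thickening.
set Z := iter k f @^-1` hull n X.
have hZ : hull n Z = Z.
  apply: hull_id => s t st [x Xx xs]; exists x => //.
  exact: agree_trans xs (fn _ _ st).
have mZ : measurable (Z : set cantor_borel) by rewrite -hZ; exact: measurable_hull.
apply: (@le_trans _ _ (iter k (induced_map f) mu (hull n X))).
  apply: le_measure; rewrite ?inE//; first exact: measurable_hull.
  by move=> x Xx; exists x.
rewrite !iter_induced_mapE -/Z.
apply: le_trans (munu _ mZ) _; apply: leeD; last by rewrite lee_fin.
apply: le_measure; rewrite ?inE//.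
- exact: measurable_thickening.
- by rewrite -[X in _ `<=` X]hZ; exact: thickening_hull.
Qed.

Lemma equicontinuous_induced_map f mu :
  (forall N, eventually_stable N f) ->
  equicontinuous_at prohorov_cantor (induced_map f) mu.
Proof.
move=> fs e e0.
have [N Ne] := ltr_add_invr e0; rewrite add0r in Ne.
have [n Nn fn] := fs N.
have {}Ne : n.+1%:R^-1 < e.
  by apply: le_lt_trans Ne; rewrite lef_pV2 ?posrE ?ltr0n// ler_nat ltnS.
(* This radius depends on [f] and [e] but not on [mu], and it also bounds the distance between all
   iterates. *)
exists n.+1%:R^-1; first by rewrite invr_gt0 ltr0n.
move=> nu numu k; apply: le_lt_trans Ne.
have [|d [d0 dle] dn] := inf_lt _ numu.
  (* The infimum is over a nonempty set: 1 is admissible since probabilities are at most 1. *)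
  exists 1; split => // X mX.
  by split; apply: le_trans (probability_le1 _ mX) _; rewrite leeDr.
apply: ge_inf; first by exists 0 => x [/ltW].
split; first by rewrite invr_gt0 ltr0n.
by move=> X mX; split; apply: iter_induced_map_le fn (ltW dn) _ mX => Z /dle[].
Qed.

End cylinders.

Theorem theorem4 (R : realType) :
  meager [set f : cantor_maps R | exists mu : cantor_measures R,
    ~ equicontinuous_at prohorov_cantor (induced_map f) mu].
Proof.
set A := [set f | _].
(* [meager] asks for an equality, hence the intersection of each complement with [A]. *)
exists (fun N => A `&` ~` eventually_stable N) => [N|].
  apply: (@nowhere_dense_subC _ (eventually_stable N)).
  - exact: open_eventually_stable.
  - exact: dense_eventually_stable.
  - exact: subIsetr.
rewrite -setI_bigcupr; apply/esym/setIidPl => f [mu fmu].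
apply: contrapT => nst; apply: fmu; apply: equicontinuous_induced_map => N.
by apply: contrapT => Nf; apply: nst; exists N.
Qed.
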